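(* $F_{\mathrm{strong}}\not\preceq\mathrm{WL}_{3/2}$: there exist graphs $G$ and $H$ with $\mathrm{WL}_{3/2}(G)=\mathrm{WL}_{3/2}(H)$ but $F_{\mathrm{strong}}(G)\ne F_{\mathrm{strong}}(H)$. Consequently also $F_{\mathrm{weak}}$ is strictly weaker than $F_{\mathrm{strong}}$ (there are graphs with equal $F_{\mathrm{weak}}$ and different $F_{\mathrm{strong}}$).
   Context: Graphs are finite, simple and undirected with adjacency matrix $A$. $\mathrm{Spec}(G)$ is the multiset of eigenvalues of $A$. Let $\mu_1<\dots<\mu_m$ be the distinct eigenvalues, $P_i$ the orthogonal projection matrix onto the eigenspace of $\mu_i$, $P_*(x,y)=(P_1(x,y),\dots,P_m(x,y))$. Fürer's strong spectral invariant is $F_{\mathrm{strong}}(G)=\big(\mathrm{Spec}(G),\{\!\{(P_*(x,x),\{\!\{(P_*(x,y),P_*(y,y))\}\!\}_{y\in V(G)})\}\!\}_{x\in V(G)}\big)$ and the weak one is $F_{\mathrm{weak}}(G)=\big(\mathrm{Spec}(G),\{\!\{(P_*(x,x),\{\!\{P_*(x,y)\}\!\}_{y})\}\!\}_{x}\big)$, where $\{\!\{\cdot\}\!\}$ denotes a multiset. Color refinement (1-WL) on a vertex-colored $n$-vertex graph: $C^0(x)$ is the color of $x$ (uniform if uncolored), $C^{r+1}(x)=\big(C^r(x),\{\!\{C^r(y)\}\!\}_{y\in N(x)}\big)$; $\mathrm{WL}_1(G)=\{\!\{C^n(x)\}\!\}_{x\in V(G)}$. $G_x$ is $G$ with vertex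 $x$ individualized (given a special new color, the same for all choices of $x$). $\mathrm{WL}_{3/2}(G)=\{\!\{\mathrm{WL}_1(G_x)\}\!\}_{x\in V(G)}$. *)

(* Defs.v *)
From HB Require Import structures.
From mathcomp Require Import all_boot all_order all_algebra.
From mathcomp Require Import finmap multiset.
From mathcomp Require Import polyrcf.
From mathcomp Require Import Rstruct.

Set Implicit Arguments.
Unset Strict Implicit.
Unset Printing Implicit Defensive.

Import Order.TTheory GRing.Theory Num.Theory.
Local Open Scope ring_scope.

Notation R := Rdefinitions.R.

Definition simple_graph (n : nat) (e : rel 'I_n) : Prop :=
  symmetric e /\ irreflexive e.

Definition adjmx (n : nat) (e : rel 'I_n) : 'M[R]_n :=
  \matrix_(i, j) (e i j)%:R.

Definition adjpoly (n : nat) (e : rel 'I_n) : {poly R} := char_poly (adjmx e).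

(* The distinct eigenvalues mu_1 < ... < mu_m (all real roots of the
   characteristic polynomial, sorted increasingly, without repetitions). *)
Definition eigs (n : nat) (e : rel 'I_n) : seq R := rootsR (adjpoly e).

Definition spec (n : nat) (e : rel 'I_n) : multiset R :=
  seq_mset (flatten [seq nseq (mup mu (adjpoly e)) mu | mu <- eigs e]).

Definition orthproj (n : nat) (E : 'M[R]_n) : 'M[R]_n :=
  let B := row_base E in (B^T *m invmx (B *m B^T) *m B).

Definition eigproj (n : nat) (e : rel 'I_n) (mu : R) : 'M[R]_n :=
  orthproj (eigenspace (adjmx e) mu).

Definition Pstar (n : nat) (e : rel 'I_n) (x y : 'I_n) : seq R :=
  [seq eigproj e mu x y | mu <- eigs e].

Definition Fstrong (n : nat) (e : rel 'I_n) :=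
  (spec e,
   seq_mset [seq (Pstar e x x,
                  seq_mset [seq (Pstar e x y, Pstar e y y) | y <- enum 'I_n])
            | x <- enum 'I_n]).

Definition Fweak (n : nat) (e : rel 'I_n) :=
  (spec e,
   seq_mset [seq (Pstar e x x, seq_mset [seq Pstar e x y | y <- enum 'I_n])
            | x <- enum 'I_n]).

(* Colors of color refinement after r rounds:
   round 0: bool (true = the special individualization color),
   round r+1: pair (old color, multiset of old colors of the neighbours). *)
Fixpoint colT (r : nat) : choiceType :=
  if r is r'.+1 then Choice.clone (colT r' * multiset (colT r'))%type _
  else bool.

Fixpoint wlcol (n : nat) (e : rel 'I_n) (x : 'I_n) (r : nat) : 'I_n -> colT r :=
  match r return 'I_n -> colT r with
  | 0 => fun v => (v == x)
  | r'.+1 => fun v =>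
      (wlcol e x r' v, seq_mset [seq wlcol e x r' u | u <- enum 'I_n & e v u])
  end.

Definition WL1_ind (n : nat) (e : rel 'I_n) (x : 'I_n) : multiset (colT n) :=
  seq_mset [seq wlcol e x n v | v <- enum 'I_n].

Definition WL32 (n : nat) (e : rel 'I_n) : multiset (multiset (colT n)) :=
  seq_mset [seq WL1_ind e x | x <- enum 'I_n].

(* Main.v *)
(* Take four modules of six vertices, two inducing 2 C_3 and two inducing C_6.
   In G each module is completely joined to the other module of its isomorphism
   type; in H each 2 C_3 is joined to a C_6. Color refinement after
   individualizing x only distinguishes vertices inside the module of x: all
   vertices of the joined module look alike, and so do those of the two
   remaining modules, because 2 C_3 and C_6 are both 2-regular. Hence WL_{3/2}
   does not tell G from H. Counting walks along the same stable coloring gives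
   equal entries of all powers of A, and P_mu is a Lagrange polynomial in A
   depending on the spectrum only, so F_weak does not tell them apart either.
   Conversely P_* determines the powers of A, by the spectral decomposition.
   So F_strong sees, for x in a 2 C_3, whether the vertices y joined to it from
   outside (the neighbors with A^2(x,y) = 4) lie on as many triangles as x,
   which happens in G and not in H. *)
Require Import Defs.
From HB Require Import structures.
From mathcomp Require Import all_boot all_order all_algebra.
From mathcomp Require Import finmap multiset.
From mathcomp Require Import polyrcf Rstruct.

Set Implicit Arguments.
Unset Strict Implicit.
Unset Printing Implicit Defensive.

Import Order.TTheory GRing.Theory Num.Theory.
Local Open Scope ring_scope.

(** * Comparing multisets through common labels *)

(** Pair each element of [s] with one of [s'] of the same label; [f] and [f'] agree on every pair.
    Colors, sums over neighbors and rows of projections are all compared this way. *)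
Lemma perm_map_transfer (T T' : Type) (L K : eqType) (c : T -> L) (c' : T' -> L)
    (f : T -> K) (f' : T' -> K) (s : seq T) (s' : seq T') :
  (forall u u', c u = c' u' -> f u = f' u') ->
  perm_eq (map c s) (map c' s') -> perm_eq (map f s) (map f' s').
Proof.
move=> cf; elim: s s' => [|u s IHs] s'.
  by move/perm_size; rewrite size_map; case: s'.
move=> eq_cs; have cu_s': c u \in map c' s'.
  by rewrite -(perm_mem eq_cs) mem_head.
(* [s'] is nonempty, which supplies the default for [nth]. *)
have [u0 _]: exists u0 : T', True by case: s' cu_s' {eq_cs} => // u0; exists u0.
pose i := index (c u) (map c' s').
have lt_i: (i < size s')%N by rewrite -(size_map c') index_mem.
have Ds': s' = take i s' ++ nth u0 s' i :: drop i.+1 s'.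
  by rewrite -drop_nth // cat_take_drop.
have Ecu: c u = c' (nth u0 s' i) by rewrite -(nth_map u0 (c u)) // nth_index.
move: (nth u0 s' i) Ds' Ecu => u' -> Ecu in eq_cs *.
move: eq_cs; rewrite !map_cat /= -(cf _ _ Ecu) -Ecu.
rewrite perm_sym perm_catC /= perm_cons -map_cat => eq_cs.
rewrite perm_sym perm_catC /= perm_cons -map_cat perm_sym.
by apply: IHs; rewrite perm_sym.
Qed.

(** * Gram matrices, polynomials in a matrix, interpolation *)

Section RealMatrices.

Variable F : realFieldType.

Lemma mul_tr_eq0 (m n : nat) (A : 'M[F]_(m, n)) : A *m A^T = 0 -> A = 0.
Proof.
move=> AA0; apply/matrixP=> i j; rewrite mxE.
have /eqP := congr1 (fun B : 'M_m => B i i) AA0.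
rewrite !mxE psumr_eq0 => [/allP/(_ j (mem_index_enum j))|k _].
  by rewrite mxE mulf_eq0 orbb => /eqP.
by rewrite mxE -expr2 sqr_ge0.
Qed.

(** Makes [invmx] in [orthproj] a true inverse. If [K] annihilates the Gram matrix, then
    [(K B)(K B)^T = 0], so [K B = 0] and [K = 0]. *)
Lemma row_free_gram (m n : nat) (B : 'M[F]_(m, n)) :
  row_free B -> B *m B^T \in unitmx.
Proof.
move=> freeB; rewrite -row_free_unit -kermx_eq0; apply/eqP.
apply: (row_free_inj freeB); rewrite mul0mx; apply: mul_tr_eq0.
by rewrite trmx_mul mulmxA -(mulmxA _ B) mulmx_ker mul0mx.
Qed.

(** Over polynomials, [U] intertwines [X - A] and [X - B]; take determinants and cancel [\det U]. *)
Lemma char_poly_intertwine (n : nat) (A B U : 'M[F]_n) :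
  U \in unitmx -> A *m U = U *m B -> char_poly A = char_poly B.
Proof.
move=> unitU AU; pose U' := map_mx (@polyC F) U.
have nzU': \det U' != 0.
  by rewrite det_map_mx polyC_eq0 -unitfE -unitmxE.
have E: char_poly_mx A *m U' = U' *m char_poly_mx B.
  by rewrite mulmxBl mulmxBr -!map_mxM AU mul_scalar_mx mul_mx_scalar.
apply: (mulIf nzU'); rewrite [RHS]mulrC.
by rewrite -!det_mulmx E.
Qed.

Lemma tr_horner_mx (n : nat) (A : 'M[F]_n.+1) (p : {poly F}) :
  A^T = A -> (horner_mx A p)^T = horner_mx A p.
Proof.
move=> symA; elim/poly_ind: p => [|p c IHp]; first by rewrite rmorph0 trmx0.
rewrite rmorphD rmorphM /= horner_mx_X horner_mx_C linearD /= tr_scalar_mx.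
rewrite -mulmxE trmx_mul IHp symA; congr (_ + _).
by apply: comm_mx_horner.
Qed.

Lemma eigen_horner_mx (m n : nat) (A : 'M[F]_n.+1) (E : 'M[F]_(m, n.+1))
    (a : F) (p : {poly F}) :
  E *m A = a *: E -> E *m horner_mx A p = p.[a] *: E.
Proof.
move=> EA; elim/poly_ind: p => [|p c IHp].
  by rewrite rmorph0 mulmx0 horner0 scale0r.
rewrite rmorphD rmorphM /= horner_mx_X horner_mx_C -mulmxE mulmxDr mulmxA IHp.
by rewrite -scalemxAl EA mul_mx_scalar scalerA -scalerDl !hornerE.
Qed.

Lemma horner_mx_entries (m n : nat) (A : 'M[F]_m.+1) (B : 'M[F]_n.+1) x y x' y'
    (p : {poly F}) :
  (forall k, (A ^+ k) x y = (B ^+ k) x' y') ->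
  horner_mx A p x y = horner_mx B p x' y'.
Proof.
move=> eqAB; rewrite -[p]coefK poly_def !rmorph_sum !summxE /=.
apply: eq_bigr => i _.
by rewrite !horner_mxZ !rmorphXn /= !horner_mx_X !mxE eqAB.
Qed.

(** [p - q] vanishes on [s], hence is a multiple of the annihilating product. *)
Lemma horner_mx_agree (n : nat) (A : 'M[F]_n.+1) (s : seq F) (p q : {poly F}) :
    uniq s -> horner_mx A (\prod_(a <- s) ('X - a%:P)) = 0 ->
    {in s, forall a, p.[a] = q.[a]} ->
  horner_mx A p = horner_mx A q.
Proof.
move=> uniq_s As0 eq_pq; apply/eqP; rewrite -subr_eq0 -rmorphB; apply/eqP.
have [||r ->] := @uniq_roots_prod_XsubC _ (p - q) s.
- by apply/allP=> a s_a; rewrite rootE !hornerE eq_pq // subrr.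
- by rewrite uniq_rootsE.
by rewrite rmorphM /= As0 mulr0.
Qed.

Definition lagrange (s : seq F) (a : F) : {poly F} :=
  \prod_(b <- s | b != a) ((a - b)^-1 *: ('X - b%:P)).

Lemma lagrangeE (s : seq F) (a b : F) :
  b \in s -> (lagrange s a).[b] = (b == a)%:R.
Proof.
move=> s_b; rewrite horner_prod; have [->|ne_ba] := eqVneq b a.
  by rewrite big1 // => c ne_ca; rewrite !hornerE mulVf // subr_eq0 eq_sym.
by rewrite (big_rem b) //= ne_ba !hornerE subrr mulr0 mul0r.
Qed.

End RealMatrices.

(** * Characterization of the orthogonal projection *)

Section OrthogonalProjection.

Variables (n : nat) (E : 'M[R]_n).

Lemma orthproj_sub : (orthproj E <= E)%MS.
Proof. by rewrite (submx_trans (submxMl _ _)) ?eq_row_base ?submx_refl. Qed.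

Lemma tr_orthproj : (orthproj E)^T = orthproj E.
Proof.
rewrite /orthproj; move: (row_base E) => B.
by rewrite !trmx_mul trmx_inv trmx_mul trmxK mulmxA.
Qed.

Lemma orthproj_id (m : nat) (V : 'M[R]_(m, n)) :
  (V <= E)%MS -> V *m orthproj E = V.
Proof.
rewrite -(eq_row_base E) /orthproj => /submxP[W ->].
move: (row_base E) (row_base_free E) W => B freeB W.
by rewrite !mulmxA -(mulmxA W) mulmxK // row_free_gram.
Qed.

(** With [P] the projection, [P Q = P] and [Q P = Q]; transposing the latter gives [P Q = Q]. *)
Lemma orthproj_unique (Q : 'M[R]_n) :
  Q^T = Q -> (Q <= E)%MS -> E *m Q = E -> orthproj E = Q.
Proof.
move=> symQ QE EQ; have /submxP[W P_E] := orthproj_sub.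
have PQ: orthproj E *m Q = orthproj E by rewrite P_E -mulmxA EQ.
by rewrite -PQ -{1}tr_orthproj -{1}symQ -trmx_mul orthproj_id.
Qed.

End OrthogonalProjection.

(** * Spectral decomposition of the adjacency matrix *)

Section Spectrum.

Variables (n : nat) (e : rel 'I_n.+1).
Hypothesis graph_e : simple_graph e.

Let A := adjmx e.

Lemma tr_adjmx : A^T = A.
Proof. by apply/matrixP=> i j; rewrite !mxE graph_e.1. Qed.

Lemma mem_eigs a : (a \in eigs e) = eigenvalue A a.
Proof.
rewrite eigenvalue_root_char /eigs.
have /roots_on_rootsR/(_ a) <- : adjpoly e != 0.
  by rewrite monic_neq0 ?char_poly_monic.
by rewrite in_itv.
Qed.

Variable s : seq R.
Hypotheses (uniq_s : uniq s)
  (ann_s : horner_mx A (\prod_(a <- s) ('X - a%:P)) = 0).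

(** On an eigenvector the annihilating product acts as its value at the eigenvalue. [s] may contain
    further numbers, so checking annihilation is enough for a concrete graph. *)
Lemma eigs_sub : {subset eigs e <= s}.
Proof.
move=> a; rewrite mem_eigs => /eigenvalueP[v vA nz_v].
have /esym/eqP := eigen_horner_mx (\prod_(a <- s) ('X - a%:P)) vA.
by rewrite ann_s mulmx0 scaler_eq0 (negPf nz_v) orbF -rootE root_prod_XsubC.
Qed.

(** The right side is symmetric, its rows are eigenvectors because ['X * lagrange s a] and
    [a *: lagrange s a] agree on [s], and it fixes the eigenspace. *)
Lemma eigproj_lagrange a : a \in s -> eigproj e a = horner_mx A (lagrange s a).
Proof.
move=> s_a; apply: orthproj_unique; first exact: tr_horner_mx tr_adjmx.
  apply/eigenspaceP; rewrite mulmxE -[X in _ * X](horner_mx_X A) -rmorphM.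
  rewrite -horner_mxZ; apply: (horner_mx_agree uniq_s ann_s) => b s_b.
  rewrite !hornerE lagrangeE //.
  by have [->|] := eqVneq b a; rewrite ?mul1r ?mulr1 ?mul0r ?mulr0.
have /eigenspaceP := submx_refl (eigenspace A a).
by move/eigen_horner_mx->; rewrite lagrangeE // eqxx scale1r.
Qed.

Lemma adjmx_exp_eigproj k : A ^+ k = \sum_(a <- eigs e) a ^+ k *: eigproj e a.
Proof.
have -> : A ^+ k = \sum_(a <- s) a ^+ k *: eigproj e a.
  rewrite -(horner_mx_X A) -rmorphXn /=.
  rewrite (horner_mx_agree (q := \sum_(a <- s) a ^+ k *: lagrange s a)
             uniq_s) //.
    rewrite rmorph_sum; apply: eq_big_seq => a s_a /=.
    by rewrite horner_mxZ eigproj_lagrange.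
  move=> a s_a; rewrite horner_sum hornerXn (big_rem a) //= big1_seq ?addr0.
    by rewrite hornerZ lagrangeE // eqxx mulr1.
  move=> b /andP[_]; rewrite mem_rem_uniq // => /andP[ne_ba _].
  by rewrite hornerZ lagrangeE // eq_sym (negPf ne_ba) mulr0.
(* A member of [s] that is not an eigenvalue has zero eigenspace, so its term vanishes. *)
rewrite (bigID (mem (eigs e))) /= [X in _ + X]big1 ?addr0 => [|a]; last first.
  rewrite mem_eigs negbK => /eqP E0.
  rewrite /eigproj (orthproj_unique (Q := 0)) ?trmx0 ?scaler0 ?sub0mx //.
  by rewrite E0 mul0mx.
rewrite -big_filter; apply: perm_big; apply: uniq_perm.
- exact: filter_uniq.
- exact: uniq_roots.
move=> a; rewrite mem_filter; apply/andP/idP=> [[]//|e_a].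
by split=> //; apply: eigs_sub.
Qed.

Lemma Pstar_exp x y k :
  (A ^+ k) x y = \sum_(u <- zip (eigs e) (Pstar e x y)) u.1 ^+ k * u.2.
Proof.
rewrite adjmx_exp_eigproj summxE /Pstar -{2}(map_id (eigs e)) zip_map big_map.
by apply: eq_bigr => a _; rewrite mxE.
Qed.

End Spectrum.

(** * Labelings that are equitable across two graphs *)

Section Labels.

Variables (n : nat) (e e' : rel 'I_n) (x x' : 'I_n) (L : eqType).
Variables (c c' : 'I_n -> L).
Hypothesis c_root : forall v v', c v = c' v' -> (v == x) = (v' == x').
Hypothesis c_nbr : forall v v', c v = c' v' ->
  perm_eq [seq c u | u <- enum 'I_n & e v u]
          [seq c' u | u <- enum 'I_n & e' v' u].

Lemma wlcol_label r v v' : c v = c' v' -> wlcol e x r v = wlcol e' x' r v'.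
Proof.
elim: r => [|r IHr] /= in v v' *; first exact: c_root.
move=> cv; congr (_, _); first exact: IHr.
by apply/eq_seq_msetP; apply: perm_map_transfer (c_nbr cv).
Qed.

Lemma adjmx_mul_label (f f' : 'I_n -> R) :
  (forall v v', c v = c' v' -> f v = f' v') ->
  forall v v', c v = c' v' ->
  \sum_u adjmx e v u * f u = \sum_u adjmx e' v' u * f' u.
Proof.
have sumE (d : rel 'I_n) (g : 'I_n -> R) v :
    \sum_u adjmx d v u * g u = \sum_(a <- [seq g u | u <- enum 'I_n & d v u]) a.
  rewrite big_map big_filter big_enum_cond /= [RHS]big_mkcond.
  by apply: eq_bigr => u _; rewrite mxE; case: (d v u); rewrite ?mul1r ?mul0r.
move=> cf v v' cv; rewrite !sumE; apply: perm_big.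
by apply: perm_map_transfer (c_nbr cv).
Qed.

End Labels.

(** Column [x] of a power arises from the indicator of [x], a function of the label, by repeated
    multiplication with the adjacency matrix, which preserves such functions. *)
Lemma adjmx_exp_label (n : nat) (e e' : rel 'I_n.+1) (x x' : 'I_n.+1)
    (L : eqType) (c c' : 'I_n.+1 -> L) :
    (forall v v', c v = c' v' -> (v == x) = (v' == x')) ->
    (forall v v', c v = c' v' ->
       perm_eq [seq c u | u <- enum 'I_n.+1 & e v u]
               [seq c' u | u <- enum 'I_n.+1 & e' v' u]) ->
  forall k v v', c v = c' v' -> (adjmx e ^+ k) v x = (adjmx e' ^+ k) v' x'.
Proof.
move=> c_root c_nbr; elim=> [|k IHk] v v' cv.
  by rewrite !mxE (c_root _ _ cv).
rewrite !exprS -!mulmxE !mxE.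
exact: (adjmx_mul_label (f := fun u => (adjmx e ^+ k) u x)
                        (f' := fun u => (adjmx e' ^+ k) u x') c_nbr IHk).
Qed.

Lemma WL32_label (n : nat) (e e' : rel 'I_n) (L : eqType)
    (c c' : 'I_n -> 'I_n -> L) :
    (forall x v v', c x v = c' x v' -> (v == x) = (v' == x)) ->
    (forall x v v', c x v = c' x v' ->
       perm_eq [seq c x u | u <- enum 'I_n & e v u]
               [seq c' x u | u <- enum 'I_n & e' v' u]) ->
    (forall x, perm_eq [seq c x u | u <- enum 'I_n]
                       [seq c' x u | u <- enum 'I_n]) ->
  WL32 e = WL32 e'.
Proof.
move=> c_root c_nbr c_all; congr seq_mset; apply: eq_map => x.
apply/eq_seq_msetP; apply: perm_map_transfer (c_all x) => v v'.
by apply: wlcol_label; [apply: c_root|apply: c_nbr].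
Qed.

(** * Spectral invariants of two cospectral graphs *)

Section TwoGraphs.

Variables (n : nat) (e e' : rel 'I_n.+1) (s : seq R).
Hypotheses (graph_e : simple_graph e) (graph_e' : simple_graph e').
Hypotheses (uniq_s : uniq s)
  (ann_e : horner_mx (adjmx e) (\prod_(a <- s) ('X - a%:P)) = 0)
  (ann_e' : horner_mx (adjmx e') (\prod_(a <- s) ('X - a%:P)) = 0).
Hypothesis eq_adjpoly : adjpoly e = adjpoly e'.

Lemma eq_eigs : eigs e = eigs e'.
Proof. by rewrite /eigs eq_adjpoly. Qed.

Lemma exp_eq_Pstar x y x' y' :
  Pstar e x y = Pstar e' x' y' ->
  forall k, (adjmx e ^+ k) x y = (adjmx e' ^+ k) x' y'.
Proof.
move=> eqP k; rewrite (Pstar_exp graph_e uniq_s) //.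
rewrite (Pstar_exp graph_e' uniq_s) //.
by rewrite eqP eq_eigs.
Qed.

Lemma Pstar_eq_exp x y x' y' :
  (forall k, (adjmx e ^+ k) x y = (adjmx e' ^+ k) x' y') ->
  Pstar e x y = Pstar e' x' y'.
Proof.
move=> eqX; rewrite /Pstar eq_eigs; apply/eq_in_map => a e'a.
have s_a := eigs_sub ann_e' e'a.
rewrite (eigproj_lagrange graph_e uniq_s) //.
rewrite (eigproj_lagrange graph_e' uniq_s) //.
exact: horner_mx_entries.
Qed.

Lemma Fweak_label (L : eqType) (c c' : 'I_n.+1 -> 'I_n.+1 -> L) :
    (forall x v v', c x v = c' x v' -> (v == x) = (v' == x)) ->
    (forall x v v', c x v = c' x v' ->
       perm_eq [seq c x u | u <- enum 'I_n.+1 & e v u]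
               [seq c' x u | u <- enum 'I_n.+1 & e' v' u]) ->
    (forall x, perm_eq [seq c x u | u <- enum 'I_n.+1]
                       [seq c' x u | u <- enum 'I_n.+1]) ->
  Fweak e = Fweak e'.
Proof.
move=> c_root c_nbr c_all; congr (_, seq_mset _).
  by rewrite /spec eq_eigs eq_adjpoly.
have Pstar_label x v v' : c x v = c' x v' -> Pstar e x v = Pstar e' x v'.
  move=> cv; apply: Pstar_eq_exp => k.
  (* Labels control column [x], whereas [Pstar] reads row [x]; powers are symmetric. *)
  have trX (d : rel 'I_n.+1) : simple_graph d ->
      (adjmx d ^+ k)^T = adjmx d ^+ k.
    move=> graph_d; rewrite -(horner_mx_X (adjmx d)) -rmorphXn.
    exact: tr_horner_mx (tr_adjmx graph_d).
  rewrite -trX // -[in RHS]trX // !mxE.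
  exact: adjmx_exp_label (c_root x) (c_nbr x) k v v' cv.
apply: eq_map => x; congr (_, _).
  apply: Pstar_label.
  (* The label of [x] occurs in the other graph, and by [c_root] only at [x]. *)
  have: c x x \in [seq c' x u | u <- enum 'I_n.+1].
    by rewrite -(perm_mem (c_all x)) map_f ?mem_enum.
  case/mapP=> v' _ cx; rewrite cx; congr (c' x _).
  by apply/eqP; rewrite -(c_root _ _ _ cx).
by apply/eq_seq_msetP; apply: perm_map_transfer (c_all x) => v v' /Pstar_label.
Qed.

(** The outer multiset gives a partner for [x], and the inner multiset at that partner gives one for
    [y]. *)
Lemma exp_eq_Fstrong x y :
    Fstrong e = Fstrong e' ->
  exists x', exists y', forall k,
    [/\ (adjmx e ^+ k) x x = (adjmx e' ^+ k) x' x',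
        (adjmx e ^+ k) x y = (adjmx e' ^+ k) x' y' &
        (adjmx e ^+ k) y y = (adjmx e' ^+ k) y' y'].
Proof.
case=> _ /eq_seq_msetP/perm_mem eqF.
set f := (fun z : 'I_n.+1 => (Pstar e z z, _)) in eqF.
have := map_f f (mem_enum 'I_n.+1 x); rewrite eqF => /mapP[x' _ [Pxx]].
move/eq_seq_msetP/perm_mem => {}eqF.
set g := (fun z : 'I_n.+1 => (Pstar e x z, _)) in eqF.
have := map_f g (mem_enum 'I_n.+1 y); rewrite eqF => /mapP[y' _ [Pxy Pyy]].
by exists x', y' => k; split; apply: exp_eq_Pstar.
Qed.

End TwoGraphs.

(** * The two graphs on 24 vertices *)

(* Module m consists of the vertices 6m, ..., 6m+5 and induces 2 C_3 if m < 2
   and C_6 otherwise; modules are completely joined when p agrees on them. *)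
Definition module_adj (p : nat -> nat) (i j : nat) : bool :=
  (let m := i %/ 6 in let m' := j %/ 6 in
   if m != m' then p m == p m'
   else if m < 2 then (i != j) && (i %/ 3 == j %/ 3)
   else (i.+1 == j %[mod 6]) || (j.+1 == i %[mod 6]))%N.

Definition module_graph (p : nat -> nat) : rel 'I_24 :=
  fun i j => module_adj p i j.

Lemma all_ordP (n : nat) (P : pred nat) :
  all P (iota 0 n) -> forall i : 'I_n, P i.
Proof. by move=> /allP allP i; apply: allP; rewrite mem_iota ltn_ord. Qed.

Lemma all2_ordP (n : nat) (P : rel nat) :
  all (fun i => all (P i) (iota 0 n)) (iota 0 n) -> forall i j : 'I_n, P i j.
Proof. by move=> allP i j; apply: (all_ordP (all_ordP allP i)). Qed.

Lemma module_graph_simple (p : nat -> nat) :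
  all (fun i => all (fun j => module_adj p i j == module_adj p j i) (iota 0 24))
    (iota 0 24) ->
  all (fun i => ~~ module_adj p i i) (iota 0 24) ->
  simple_graph (module_graph p).
Proof.
move=> sym_p irr_p; split=> [i j|i]; first exact/eqP/(all2_ordP sym_p).
exact/negbTE/(all_ordP irr_p).
Qed.

(** Halving joins modules of equal type, parity joins modules of different type. *)
Definition pairG (m : nat) : nat := m./2.
Definition pairH (m : nat) : nat := odd m.

Notation graphG := (module_graph pairG).
Notation graphH := (module_graph pairH).

Lemma simple_graphG : simple_graph graphG.
Proof. by apply: module_graph_simple; vm_compute. Qed.

Lemma simple_graphH : simple_graph graphH.
Proof. by apply: module_graph_simple; vm_compute. Qed.

(** * A common equitable labeling and equality of the WL invariants *)

(** Finer than color refinement requires: the module of [x], which induces the same graph in [G] and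
    [H], is labeled discretely. The numbers 24 and 25 are not vertices. *)
Definition module_label (p : nat -> nat) (x v : nat) : nat :=
  (if v %/ 6 == x %/ 6 then v
   else if p (v %/ 6) == p (x %/ 6) then 24 else 25)%N.

Lemma map_val_filter_enum (n : nat) (f : nat -> nat) (P : pred nat) :
  [seq f (val u) | u <- enum 'I_n & P (val u)] =
  [seq f u | u <- iota 0 n & P u].
Proof. by rewrite -val_enum_ord filter_map -map_comp. Qed.

Lemma module_label_root (x v v' : 'I_24) :
  module_label pairG x v = module_label pairH x v' -> (v == x) = (v' == x).
Proof.
move/eqP=> cv; rewrite -!val_eqE; apply: (elimT eqP); move: cv; apply/implyP.
have H : all (fun x => all (fun v => all (fun v' =>
    (module_label pairG x v == module_label pairH x v') ==>
    ((v == x) == (v' == x))) (iota 0 24)) (iota 0 24)) (iota 0 24).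
  by vm_compute.
exact: (all_ordP (all_ordP (all_ordP H x) v) v').
Qed.

Lemma module_label_nbr (x v v' : 'I_24) :
  module_label pairG x v = module_label pairH x v' ->
  perm_eq [seq module_label pairG x (val u) | u <- enum 'I_24 & graphG v u]
          [seq module_label pairH x (val u) | u <- enum 'I_24 & graphH v' u].
Proof.
move/eqP=> cv; rewrite (map_val_filter_enum 24 (module_label pairG x)
                            (module_adj pairG v)).
rewrite (map_val_filter_enum 24 (module_label pairH x)
                            (module_adj pairH v')).
move: cv; apply/implyP.
have H : all (fun x => all (fun v => all (fun v' =>
    (module_label pairG x v == module_label pairH x v') ==>
    perm_eq
      [seq module_label pairG x u | u <- iota 0 24 & module_adj pairG v u]
      [seq module_label pairH x u | u <- iota 0 24 & module_adj pairH v' u])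
    (iota 0 24)) (iota 0 24)) (iota 0 24).
  by vm_compute.
exact: (all_ordP (all_ordP (all_ordP H x) v) v').
Qed.

Lemma module_label_perm (x : 'I_24) :
  perm_eq [seq module_label pairG x (val u) | u <- enum 'I_24]
          [seq module_label pairH x (val u) | u <- enum 'I_24].
Proof.
rewrite !(map_comp (module_label _ x) val) val_enum_ord.
have H : all (fun x => perm_eq [seq module_label pairG x u | u <- iota 0 24]
                               [seq module_label pairH x u | u <- iota 0 24])
              (iota 0 24).
  by vm_compute.
exact: (all_ordP H x).
Qed.

Lemma WL32_module_graph : WL32 graphG = WL32 graphH.
Proof.
exact: WL32_label module_label_root module_label_nbr module_label_perm.
Qed.

(** * Annihilating polynomials by integer computation *)

(** Real matrices do not compute; integer tables do, and embed into them. *)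
Definition table (f : nat -> nat -> int) : seq (seq int) :=
  mkseq (fun i => mkseq (f i) 24) 24.

Definition entry (t : seq (seq int)) (i j : nat) : int :=
  nth 0 (nth [::] t i) j.

Definition table_mul (s t : seq (seq int)) : seq (seq int) :=
  table (fun i j =>
    foldr (fun k a => entry s i k * entry t k j + a) 0 (iota 0 24)).

Definition table_mx (t : seq (seq int)) : 'M[R]_24 :=
  \matrix_(i, j) (entry t i j)%:~R.

Lemma table_mxE (f : nat -> nat -> int) :
  table_mx (table f) = \matrix_(i, j) (f i j)%:~R.
Proof. by apply/matrixP=> i j; rewrite !mxE /entry !nth_mkseq. Qed.

Lemma table_mxM (s t : seq (seq int)) :
  table_mx (table_mul s t) = table_mx s *m table_mx t.
Proof.
rewrite table_mxE; apply/matrixP=> i j; rewrite !mxE.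
have -> : foldr (fun k a => entry s i k * entry t k j + a) 0 (iota 0 24)
    = \sum_(0 <= k < 24) entry s i k * entry t k j by rewrite unlock.
rewrite big_mkord rmorph_sum; apply: eq_bigr => k _ /=.
by rewrite !mxE rmorphM.
Qed.

Definition table_scalar (a : int) : seq (seq int) :=
  table (fun i j => a *+ (i == j)).

Lemma table_mx_scalar (a : int) : table_mx (table_scalar a) = (a%:~R)%:M.
Proof.
by rewrite table_mxE; apply/matrixP=> i j; rewrite !mxE rmorphMn.
Qed.

Definition adj_table (p : nat -> nat) : seq (seq int) :=
  table (fun i j => (module_adj p i j)%:R).

Lemma adjmx_module_graph (p : nat -> nat) :
  adjmx (module_graph p) = table_mx (adj_table p).
Proof. by rewrite table_mxE; apply/matrixP=> i j; rewrite !mxE rmorph_nat. Qed.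

Definition shift_table (p : nat -> nat) (a : int) : seq (seq int) :=
  table (fun i j => (module_adj p i j)%:R - a *+ (i == j)).

Lemma table_mx_shift (p : nat -> nat) (a : int) :
  table_mx (shift_table p a) = adjmx (module_graph p) - (a%:~R)%:M.
Proof.
rewrite adjmx_module_graph !table_mxE; apply/matrixP=> i j.
by rewrite !mxE rmorphB !rmorphMn.
Qed.

(** The averages over two joined modules give 2 + 6 and 2 - 6. Vectors of sum zero on every module
    give 2 and -1 from [2 C_3], and 1, -1 and -2 from [C_6]. *)
Definition module_eigs : seq int := [:: 8; -4; 2; -2; 1; -1].

Definition annihilator_table (p : nat -> nat) (s : seq int) : seq (seq int) :=
  foldr (fun a t => table_mul (shift_table p a) t) (table_scalar 1) s.

Lemma annihilator_tableE (p : nat -> nat) (s : seq int) :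
  table_mx (annihilator_table p s) =
  horner_mx (adjmx (module_graph p))
    (\prod_(a <- [seq a%:~R | a <- s]) ('X - a%:P)).
Proof.
elim: s => [|a s IHs] /=.
  by rewrite table_mx_scalar big_nil !rmorph1.
rewrite table_mxM IHs big_cons rmorphM /= rmorphB /= horner_mx_X horner_mx_C.
by rewrite table_mx_shift.
Qed.

Lemma uniq_module_eigs : uniq [seq a%:~R : R | a <- module_eigs].
Proof. by rewrite map_inj_uniq //; apply: intr_inj. Qed.

Lemma module_graph_annihilator (p : nat -> nat) :
  annihilator_table p module_eigs == table_scalar 0 ->
  horner_mx (adjmx (module_graph p))
    (\prod_(a <- [seq a%:~R | a <- module_eigs]) ('X - a%:P)) = 0.
Proof.
by move/eqP=> ann_p; rewrite -annihilator_tableE ann_p table_mx_scalar raddf0.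
Qed.

Lemma annG : horner_mx (adjmx graphG)
  (\prod_(a <- [seq a%:~R | a <- module_eigs]) ('X - a%:P)) = 0.
Proof. by apply: module_graph_annihilator; vm_compute. Qed.

Lemma annH : horner_mx (adjmx graphH)
  (\prod_(a <- [seq a%:~R | a <- module_eigs]) ('X - a%:P)) = 0.
Proof. by apply: module_graph_annihilator; vm_compute. Qed.

(** * Cospectrality and equality of the weak invariants *)

(* Six times the orthogonal involution that exchanges the averages over the
   modules 1 and 2 and fixes everything orthogonal to these two averages; it
   conjugates the adjacency matrices because the modules are 2-regular. *)
Definition swap_table : seq (seq int) :=
  table (fun i j =>
    let m := (i %/ 6)%N in let m' := (j %/ 6)%N in
    if [&& 0 < m < 3 & 0 < m' < 3]%N then
      if m == m' then 6 *+ (i == j) - 1 else 1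
    else 6 *+ (i == j)).

Lemma swap_table_sqr : table_mul swap_table swap_table = table_scalar 36.
Proof. by apply/eqP; vm_compute. Qed.

Lemma swap_table_conj :
  table_mul (adj_table pairG) swap_table =
  table_mul swap_table (adj_table pairH).
Proof. by apply/eqP; vm_compute. Qed.

Lemma adjpoly_module_graph : adjpoly graphG = adjpoly graphH.
Proof.
apply: (char_poly_intertwine (U := table_mx swap_table)).
  (* Six times an involution has itself divided by 36 as inverse. *)
  have UU : table_mx swap_table *m ((36%:~R)^-1 *: table_mx swap_table) = 1%:M.
    rewrite -scalemxAr -table_mxM swap_table_sqr table_mx_scalar -mul_scalar_mx.
    by rewrite -scalar_mxM mulVf // intr_eq0.
  by case/mulmx1_unit: UU.
by rewrite !adjmx_module_graph -!table_mxM swap_table_conj.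
Qed.

Lemma Fweak_module_graph : Fweak graphG = Fweak graphH.
Proof.
apply: (Fweak_label simple_graphG simple_graphH uniq_module_eigs annG annH
          adjpoly_module_graph).
- exact: module_label_root.
- exact: module_label_nbr.
- exact: module_label_perm.
Qed.

(** * Separation by the strong invariant *)

Definition pow_table (p : nat -> nat) (k : nat) : seq (seq int) :=
  iter k (table_mul (adj_table p)) (table_scalar 1).

Lemma pow_tableE (p : nat -> nat) (k : nat) (i j : 'I_24) :
  (adjmx (module_graph p) ^+ k) i j = (entry (pow_table p k) i j)%:~R.
Proof.
suff ->: adjmx (module_graph p) ^+ k = table_mx (pow_table p k) by rewrite mxE.
elim: k => [|k IHk]; first by rewrite table_mx_scalar.
by rewrite exprS IHk adjmx_module_graph -mulmxE -table_mxM.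
Qed.

(** Vertices 0 and 6 lie in the two joined [2 C_3] of [G]. Third powers count triangles, 19 at a
    vertex of a [2 C_3] and 18 in a [C_6], and so force [x] and [y] into [2 C_3] modules of [H]. The
    first power makes them adjacent; the second asks for 4 common neighbors, while neighbors within
    a [2 C_3] have 7. So they would lie in different [2 C_3], which [H] does not join. *)
Lemma pow_table_differ (x y : 'I_24) :
  ~~ [&& entry (pow_table pairG 3) 0 0 == entry (pow_table pairH 3) x x,
      entry (pow_table pairG 1) 0 6 == entry (pow_table pairH 1) x y,
      entry (pow_table pairG 2) 0 6 == entry (pow_table pairH 2) x y &
      entry (pow_table pairG 3) 6 6 == entry (pow_table pairH 3) y y].
Proof.
have H : (let G1 := pow_table pairG 1 in let G2 := pow_table pairG 2 in
    let G3 := pow_table pairG 3 in let H1 := pow_table pairH 1 in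
    let H2 := pow_table pairH 2 in let H3 := pow_table pairH 3 in
    all (fun x => all (fun y =>
      ~~ [&& entry G3 0 0 == entry H3 x x, entry G1 0 6 == entry H1 x y,
             entry G2 0 6 == entry H2 x y & entry G3 6 6 == entry H3 y y])
      (iota 0 24)) (iota 0 24)).
  by vm_compute.
exact: (all_ordP (all_ordP H x) y).
Qed.

Lemma Fstrong_module_graph : Fstrong graphG <> Fstrong graphH.
Proof.
move/(exp_eq_Fstrong simple_graphG simple_graphH uniq_module_eigs annG annH
        adjpoly_module_graph (inord 0) (inord 6)) => [x [y eqX]].
have eq_entry k (u w u' w' : 'I_24) :
    (adjmx graphG ^+ k) u w = (adjmx graphH ^+ k) u' w' ->
    entry (pow_table pairG k) u w == entry (pow_table pairH k) u' w'.
  by rewrite !pow_tableE => /intr_inj->.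
have [/eq_entry Gxx _ /eq_entry Gyy] := eqX 3.
have [_ /eq_entry Gxy1 _] := eqX 1.
have [_ /eq_entry Gxy2 _] := eqX 2.
case/negP: (pow_table_differ x y).
have [v0 v6] : \val (inord 0 : 'I_24) = 0%N /\ \val (inord 6 : 'I_24) = 6%N.
  by rewrite /= !inordK.
move: Gxx Gyy Gxy1 Gxy2; rewrite v0 v6 => Gxx Gyy Gxy1 Gxy2.
by apply/and4P; split; [exact: Gxx|exact: Gxy1|exact: Gxy2|exact: Gyy].
Qed.

Theorem theorem6p1 :
  (exists (n : nat) (G H : rel 'I_n),
      simple_graph G /\ simple_graph H /\
      WL32 G = WL32 H /\ Fstrong G <> Fstrong H) /\
  (exists (n : nat) (G H : rel 'I_n),
      simple_graph G /\ simple_graph H /\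
      Fweak G = Fweak H /\ Fstrong G <> Fstrong H).
Proof.
split; exists 24, graphG, graphH.
  split; first exact: simple_graphG.
  split; first exact: simple_graphH.
  by split; [apply: WL32_module_graph|apply: Fstrong_module_graph].
split; first exact: simple_graphG.
split; first exact: simple_graphH.
by split; [apply: Fweak_module_graph|apply: Fstrong_module_graph].
Qed.
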